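(* For any $k\ge2$ and any $\sigma\in\{+,-\}^k$, the topological entropy of the signed sawtooth map $M_\sigma$ is $\log(k)$.
   Context: For $\sigma=\sigma_0\sigma_1\cdots\sigma_{k-1}\in\{+,-\}^k$, the signed sawtooth map $M_\sigma:[0,1]\to[0,1]$ is defined, for each $0\le t\le k-1$ and $x\in[\frac tk,\frac{t+1}k)$ (with the right endpoint included when $t=k-1$), by $M_\sigma(x)=kx-t$ if $\sigma_t=+$ and $M_\sigma(x)=t+1-kx$ if $\sigma_t=-$. For a piecewise monotone (not necessarily continuous) map $f$ of a bounded real interval $I$, let $\mathcal{P}$ be the partition of $I$ into the finitely many intervals on which $f$ is strictly monotone (for $M_\sigma$: the intervals $[\frac tk,\frac{t+1}k)$, $0\le t\le k-1$, the last one closed), and let $\mathcal{P}_n$ be the partition of $I$ into the non-empty sets of the form $A_{i_1}\cap f^{-1}(A_{i_2})\cap\dots\cap f^{-(n-1)}(A_{i_n})$ with $A_{i_1},\dots,A_{i_n}\in\mathcal{P}$. The topological entropy of $f$ is $\lim_{n\to\infty}\frac1n\log|\mathcal{P}_n|$. It is a theorem of Bandt, Keller and Pompe that this equals the permutation topological entropy $\lim_{n\to\infty}\frac{\log|\operatorname{Allow}_n(f)|}{n-1}$, where $\operatorname{Allow}_n(f)$ is the set of permutations in $\mathcal{S}_n$ given by the relative order of $x,f(x),\dots,f^{n-1}(x)$ for those $x\in I$ for which these values are distinct. *)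

(* Defs.v *)
From mathcomp Require Import all_boot all_order all_algebra finmap.
From mathcomp Require Import all_classical all_reals all_analysis.

Set Implicit Arguments.
Unset Strict Implicit.
Unset Printing Implicit Defensive.

Import Order.TTheory GRing.Theory Num.Theory.
Import numFieldNormedType.Exports.

Local Open Scope classical_set_scope.
Local Open Scope ring_scope.

Definition strictly_monotone_on (R : realType) (f : R -> R) (A : set R) : Prop :=
  (forall x y, A x -> A y -> x < y -> f x < f y) \/
  (forall x y, A x -> A y -> x < y -> f y < f x).

Definition monotone_partition (R : realType) (I : set R) (f : R -> R)
    (P : set (set R)) : Prop :=
  [/\ finite_set P, partition P id I &
      forall A, P A -> is_interval A /\ strictly_monotone_on f A].

(* A self-map of I is represented by a total function f : R -> R mapping I to
   I; the intersection with I makes every preimage a preimage in I. *)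
Definition refinement (R : realType) (I : set R) (f : R -> R)
    (P : set (set R)) (n : nat) : set (set R) :=
  [set B | B !=set0 /\
     exists A : 'I_n -> set R, (forall j, P (A j)) /\
       B = I `&` \bigcap_(j in [set: 'I_n]) (iter j f @^-1` A j)].

(* The number of blocks is #|` fset_set _ |, which is the genuine cardinality
   because the refinement is finite (refinement_finite). *)
Definition has_topological_entropy (R : realType) (I : set R) (f : R -> R)
    (P : set (set R)) (h : R) : Prop :=
  (fun n : nat => n%:R^-1 * ln (#|` fset_set (refinement I f P n)|%:R : R))
    @ \oo --> h.

Inductive sign := Plus | Minus.

Definition sawtooth_lap (R : realType) (k : nat) (t : 'I_k) : interval R :=
  if t.+1 == k then `[t%:R / k%:R, t.+1%:R / k%:R]
  else `[t%:R / k%:R, t.+1%:R / k%:R[.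

(* Outside [0, 1] the value is the irrelevant default 0. *)
Definition sawtooth (R : realType) (k : nat) (sigma : k.-tuple sign) (x : R) : R :=
  if [pick t : 'I_k | x \in sawtooth_lap R t] is Some t then
    match tnth sigma t with
    | Plus => k%:R * x - t%:R
    | Minus => t.+1%:R - k%:R * x
    end
  else 0.

Definition sawtooth_partition (R : realType) (k : nat) : set (set R) :=
  [set [set` sawtooth_lap R t] | t in [set: 'I_k]].
Arguments sawtooth_partition : clear implicits.

Lemma refinement_finite (R : realType) (I : set R) (f : R -> R)
    (P : set (set R)) (n : nat) :
  finite_set P -> finite_set (refinement I f P n).
Proof.
move=> finP.
pose F (g : {ffun 'I_n -> fset_set P}) : set R :=
  I `&` \bigcap_(j in [set: 'I_n]) (iter j f @^-1` val (g j)).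
apply: (@sub_finite_set _ _ (F @` setT)); last first.
  by apply: finite_image; exact: finite_finset.
move=> B [_ [A [PA ->]]].
have mA j : A j \in fset_set P by rewrite in_fset_set// inE.
exists [ffun j => [` mA j]%fset] => //.
by rewrite /F; congr (_ `&` _); apply: eq_bigcapr => j _; rewrite ffunE.
Qed.

Section Sawtooth.
Variables (R : realType) (k : nat) (sigma : k.-tuple sign).
Hypothesis k_gt0 : (0 < k)%N.

Let kR : 0 < k%:R :> R. Proof. by rewrite ltr0n. Qed.

Lemma in_sawtooth_lap (t : 'I_k) (x : R) : x \in sawtooth_lap R t =
  (t%:R <= k%:R * x) &&
  (if t.+1 == k then k%:R * x <= k%:R else k%:R * x < t.+1%:R).
Proof.
rewrite /sawtooth_lap; case: eqP => [->|_];
  by rewrite in_itv/= ler_pdivrMr// 1?ler_pdivlMr// 1?ltr_pdivlMr// [x * _]mulrC.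
Qed.

Lemma sawtooth_lap_inj (t u : 'I_k) (x : R) :
  x \in sawtooth_lap R t -> x \in sawtooth_lap R u -> t = u.
Proof.
wlog tu : t u / (t <= u)%N.
  by move=> H; case: (leqP t u) => [|/ltnW] /H h xt xu; [exact: h|rewrite (h xu xt)].
rewrite !in_sawtooth_lap => /andP[_ xt] /andP[ux _]; apply/val_inj => /=.
apply/eqP; rewrite eqn_leq tu /=; case: eqP xt => [tk _|_ xt].
  by rewrite -ltnS tk.
by rewrite -ltnS -(ltr_nat R); exact: le_lt_trans xt.
Qed.

Lemma sawtooth_lapE (t : 'I_k) (x : R) : x \in sawtooth_lap R t ->
  sawtooth sigma x = match tnth sigma t with
                     | Plus => k%:R * x - t%:R
                     | Minus => t.+1%:R - k%:R * x
                     end.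
Proof.
move=> xt; rewrite /sawtooth; case: pickP => [u xu|/(_ t)]; last by rewrite xt.
by rewrite (sawtooth_lap_inj xu xt).
Qed.

Lemma sawtooth_lap_bounds (t : 'I_k) (x : R) : x \in sawtooth_lap R t ->
  t%:R <= k%:R * x <= t.+1%:R.
Proof.
rewrite in_sawtooth_lap => /andP[-> ] /=.
by case: eqP => [->//|_ /ltW].
Qed.

Lemma sawtooth_lap_cover (x : R) : 0 <= x <= 1 ->
  exists t : 'I_k, x \in sawtooth_lap R t.
Proof.
move=> /andP[x0 x1].
have kx0 : 0 <= k%:R * x by rewrite mulr_ge0// ltW.
have kxk : k%:R * x <= k%:R by rewrite ger_pMr.
have /andP[m1 m2] := truncn_itv kx0.
case: (ltnP (Num.truncn (k%:R * x)) k) => [mk|km].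
  exists (Ordinal mk); rewrite in_sawtooth_lap /= m1 /=.
  by case: ifP.
have lk : (k.-1 < k)%N by rewrite prednK.
exists (Ordinal lk); rewrite in_sawtooth_lap /= prednK// eqxx kxk andbT.
by apply: le_trans m1; rewrite ler_nat (leq_trans (leq_pred k)).
Qed.

Lemma sawtooth_maps (x : R) : 0 <= x <= 1 -> 0 <= sawtooth sigma x <= 1.
Proof.
move=> /sawtooth_lap_cover[t xt]; rewrite (sawtooth_lapE xt).
have /andP[a b] := sawtooth_lap_bounds xt.
case: (tnth sigma t); rewrite -natr1 in b *.
  by rewrite subr_ge0 a /= lerBlDl.
by rewrite subr_ge0 b /= lerBlDl lerD2r.
Qed.

Lemma sawtooth_partitionP :
  monotone_partition `[0, 1] (sawtooth sigma) (sawtooth_partition R k).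
Proof.
split.
- by apply: finite_image; exact: finite_finset.
- split.
  + apply/seteqP; split => [x [_ [t _ <-]] /= xt|x /=]; rewrite in_itv /=.
      have /andP[a b] := sawtooth_lap_bounds xt.
      rewrite -(pmulr_rge0 _ kR) (le_trans _ a)//= -(ler_pM2l kR) mulr1.
      by rewrite (le_trans b)// ler_nat.
    move=> /sawtooth_lap_cover[t xt].
    by exists [set` sawtooth_lap R t] => //; exists t.
  + move=> _ _ [t _ <-] [u _ <-] [x [/= xt xu]].
    by rewrite (sawtooth_lap_inj xt xu).
  + move=> _ [t _ <-]; exists (t%:R / k%:R) => /=.
    have kt : k%:R * (t%:R / k%:R) = t%:R :> R by rewrite mulrC divfK// gt_eqF.
    rewrite in_sawtooth_lap kt lexx /= ltr_nat ler_nat.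
    by rewrite ltnSn (ltnW (ltn_ord t)) if_same.
move=> _ [t _ <-]; split; first exact: interval_is_interval.
case E : (tnth sigma t); [left|right] => x y /= xt yt xy;
  rewrite (sawtooth_lapE xt) (sawtooth_lapE yt) E.
  by rewrite ltrD2r ltr_pM2l.
by rewrite ltrD2l ltrN2 ltr_pM2l.
Qed.

End Sawtooth.

(* Main.v *)
Require Import Defs.
From mathcomp Require Import all_boot all_order all_algebra finmap.
From mathcomp Require Import all_classical all_reals all_analysis.

Set Implicit Arguments.
Unset Strict Implicit.
Unset Printing Implicit Defensive.

Import Order.TTheory GRing.Theory Num.Theory.
Import numFieldNormedType.Exports.

Local Open Scope classical_set_scope.
Local Open Scope ring_scope.

(** Every branch of a signed sawtooth map sends the interior of its lap onto the
    whole open unit interval, whatever its sign ([sawtooth_preimage]). Hence a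
    point strictly between 0 and 1 can be pulled back through any prescribed
    sequence of laps without ever meeting a breakpoint, so every word of length
    n over the k laps is the itinerary of some point ([sawtooth_itinerary]). As
    the laps are disjoint, distinct words have disjoint cylinders, and the n-th
    refinement has exactly k ^ n blocks ([card_sawtooth_refinement]). The
    sequence defining the entropy is therefore equal to ln k for all positive
    n. *)

(** The endpoints are excluded because the image of a half-open lap contains 0
    but not 1, or 1 but not 0, according to the sign. The preimage found is
    again interior, which is what allows the pull-back to be iterated. *)
Lemma sawtooth_preimage (R : realType) (k : nat) (sigma : k.-tuple sign)
    (t : 'I_k) (y : R) : 0 < y < 1 ->
  exists x, [/\ 0 < x < 1, x \in sawtooth_lap R t & sawtooth sigma x = y].
Proof.
move=> /andP[y0 y1].
have k_gt0 : (0 < k)%N by exact: leq_ltn_trans (ltn_ord t).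
have kR : 0 < k%:R :> R by rewrite ltr0n.
have branch (z : R) : 0 < z < 1 ->
    let x := (t%:R + z) / k%:R in
    [/\ 0 < x < 1, x \in sawtooth_lap R t & k%:R * x = t%:R + z].
  move=> /andP[z0 z1] x.
  have kx : k%:R * x = t%:R + z by rewrite mulrC divfK// gt_eqF.
  have tz : t%:R + z < t.+1%:R by rewrite -natr1 ltrD2l.
  have tk : t.+1%:R <= k%:R :> R by rewrite ler_nat.
  split=> //.
    rewrite divr_gt0 ?ltr_wpDl//= ltr_pdivrMr// mul1r.
    exact: lt_le_trans tk.
  rewrite in_sawtooth_lap// kx tz lerDl (ltW z0) /=.
  by case: ifP => // _; rewrite ltW// (lt_le_trans tz).
(* A decreasing branch takes the value y where k x - t equals 1 - y. *)
case E : (tnth sigma t).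
- have [|x01 xt kx] := branch y; first by rewrite y0.
  by eexists; split; [exact: x01 | exact: xt |
    rewrite (sawtooth_lapE sigma k_gt0 xt) E kx addrC addKr].
- have [|x01 xt kx] := branch (1 - y); first by rewrite subr_gt0 y1 gtrBl.
  eexists; split; [exact: x01 | exact: xt |].
  by rewrite (sawtooth_lapE sigma k_gt0 xt) E kx addrA natr1 subKr.
Qed.

Lemma sawtooth_itinerary (R : realType) (k : nat) (sigma : k.-tuple sign)
    (n : nat) (w : 'I_n -> 'I_k) :
  exists2 x : R, 0 < x < 1 &
    forall j : 'I_n, iter j (sawtooth sigma) x \in sawtooth_lap R (w j).
Proof.
elim: n w => [|n IHn] w.
  exists 2^-1; last by case.
  by rewrite invr_gt0 ltr0n invf_lt1 ?ltr1n ?ltr0n.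
have [y y01 yw] := IHn (w \o lift ord0).
have [x [x01 xw fx]] := sawtooth_preimage sigma (w ord0) y01.
exists x => // j; case: (unliftP ord0 j) => [i ->|->//].
by rewrite lift0 iterSr fx; exact: yw.
Qed.

Definition sawtooth_cylinder (R : realType) (k : nat) (sigma : k.-tuple sign)
    (n : nat) (w : {ffun 'I_n -> 'I_k}) : set R :=
  `[0, 1] `&` \bigcap_(j in [set: 'I_n])
     (iter j (sawtooth sigma) @^-1` [set` sawtooth_lap R (w j)]).

Lemma sawtooth_cylinder_neq0 (R : realType) (k : nat) (sigma : k.-tuple sign)
    (n : nat) (w : {ffun 'I_n -> 'I_k}) :
  @sawtooth_cylinder R k sigma n w !=set0.
Proof.
have [x /andP[x0 x1] xw] := sawtooth_itinerary R sigma w.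
exists x; split => [/=|j _]; last exact: xw.
by rewrite in_itv /= !ltW.
Qed.

(** A point of a cylinder determines its word, because each iterate lies in
    one lap only; non-emptiness of the cylinders turns this into
    injectivity. *)
Lemma sawtooth_cylinder_inj (R : realType) (k : nat) (sigma : k.-tuple sign)
    (n : nat) : injective (@sawtooth_cylinder R k sigma n).
Proof.
move=> w v wv; have [x xw] := sawtooth_cylinder_neq0 R sigma w.
have xv : sawtooth_cylinder sigma v x by rewrite -wv.
apply/ffunP => j; have k_gt0 := leq_ltn_trans (leq0n _) (ltn_ord (w j)).
exact: (sawtooth_lap_inj k_gt0 (xw.2 j I) (xv.2 j I)).
Qed.

Lemma sawtooth_refinementE (R : realType) (k : nat) (sigma : k.-tuple sign)
    (n : nat) :
  refinement `[0, 1] (sawtooth sigma) (sawtooth_partition R k) n =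
  range (@sawtooth_cylinder R k sigma n).
Proof.
apply/seteqP; split => [_ [_ [A [PA ->]]]|_ [w _ <-]].
  have lapA j : exists t : 'I_k, [set` sawtooth_lap R t] = A j.
    by have [t _ tA] := PA j; exists t.
  have [w wA] := choice lapA.
  exists (finfun w) => //; congr (_ `&` _).
  by apply: eq_bigcapr => j _; rewrite ffunE wA.
split; first exact: sawtooth_cylinder_neq0.
by exists (fun j => [set` sawtooth_lap R (w j)]); split => // j; exists (w j).
Qed.

Lemma card_sawtooth_refinement (R : realType) (k : nat) (sigma : k.-tuple sign)
    (n : nat) :
  #|` fset_set (refinement `[0, 1] (sawtooth sigma)
                  (sawtooth_partition R k) n)| = (k ^ n)%N.
Proof.
have fin : finite_set [set: {ffun 'I_n -> 'I_k}] by exact: finite_finset.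
rewrite sawtooth_refinementE fset_set_image//.
rewrite (card_imfset _ _ (@sawtooth_cylinder_inj R k sigma n)) /=.
have -> : fset_set [set: {ffun 'I_n -> 'I_k}] =
          [fset w in [pred w : {ffun 'I_n -> 'I_k} | true]]%fset.
  by apply/fsetP => w; rewrite in_fset_set// in_setT !inE.
by rewrite card_imfset //= -cardE card_ffun !card_ord.
Qed.

Theorem corollary8p1 (R : realType) (k : nat) (sigma : k.-tuple sign)
    (k_ge2 : (2 <= k)%N) :
  has_topological_entropy `[0, 1] (sawtooth sigma) (sawtooth_partition R k)
    (ln k%:R).
Proof.
rewrite /has_topological_entropy; apply: cvg_near_cst; near=> n.
have n_gt0 : (0 < n)%N by near: n; exists 1%N.
rewrite card_sawtooth_refinement natrX lnXn ?ltr0n ?(ltnW k_ge2)//.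
by rewrite -[ln _ *+ n]mulr_natl mulKf// pnatr_eq0 -lt0n.
Unshelve. all: by end_near.
Qed.
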